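(* Let $n\ge1$. The class of $(\langle\ \rangle;,\mathsf A_1,\dots,\mathsf A_n,\mathsf F_1,\dots,\mathsf F_n)$-algebras that are representable by injective $n$-ary partial functions is a quasivariety, finitely axiomatised by the following (quasi)equations (each universally quantified over all element variables occurring in it): (1) $\langle \boldsymbol a; b_1,\dots,\boldsymbol a; b_n\rangle ; c = \boldsymbol a;(\boldsymbol b; c)$; (2) $\boldsymbol\pi; a = a$; (3) $\langle \mathsf A_1^n a\rangle; a = 0$ (i.e. $\langle \mathsf A_1^n a\rangle; a=\langle \mathsf A_1^n b\rangle; b$ for all $a,b$, so that $0$ is a well-defined constant); (4) $\langle a_1,\dots,a_{i-1},0,a_{i+1},\dots,a_n\rangle; b = 0$ for every $i$; (5) $\boldsymbol a; 0 = 0$; (6) $\boldsymbol a;\mathsf A_i b = \langle \mathsf A_1^n(\boldsymbol a; b)\rangle;\langle \mathsf D_1^n a_1\rangle;\cdots;\langle \mathsf D_1^n a_n\rangle; a_i$ for every $i$; (7) $\langle \mathsf D_1^n a\rangle; b=\langle \mathsf D_1^n a\rangle; c \ \wedge\ \langle \mathsf A_1^n a\rangle; b=\langle \mathsf A_1^n a\rangle; c \ \rightarrow\ b=c$; (8) $\langle \mathsf D_1^n a\rangle; a = a$; (9) $\mathsf A_i\mathsf A_j a=\mathsf A_i\mathsf A_k a$ for every $i,j,k$; (10) $\boldsymbol b; a=\boldsymbol c; a\ \rightarrow\ \boldsymbol b;\mathsf D_i a=\boldsymbol c;\mathsf D_i a$ for every $i$; (11) $\mathsf D_i(\mathsf F_i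 a)=\mathsf F_i a$ for every $i$; (12) $\langle \mathsf D_1^n(\mathsf F_i a)\rangle; a=\mathsf F_i a$ for every $i$; (13) $\boldsymbol b; a=b_i\ \rightarrow\ \boldsymbol b;\mathsf F_i a=b_i$ for every $i$.
   Context: Fix $n\ge 1$; indices $i,j,k$ range over $\{1,\dots,n\}$. The signature has an $(n+1)$-ary operation (composition), written $\langle a_1,\dots,a_n\rangle ; b$, and unary operations $\mathsf A_1,\dots,\mathsf A_n,\mathsf F_1,\dots,\mathsf F_n$. Algebras are nonempty. An $n$-ary partial function on a set $X$ is a set $f\subseteq X^{n+1}$ such that $(\boldsymbol x,y),(\boldsymbol x,z)\in f$ implies $y=z$ (where $\boldsymbol x\in X^n$); it is injective if $(\boldsymbol x,z),(\boldsymbol y,z)\in f$ implies $\boldsymbol x=\boldsymbol y$. An algebra of $n$-ary partial functions of this signature is an algebra whose elements are $n$-ary partial functions, for which there are a set $X$ (the base) and an equivalence relation $E$ on $X$ such that every tuple $(x_1,\dots,x_{n+1})$ in every element lies in $X^{n+1}$ and has pairwise $E$-equivalent entries, and whose operations are $\boldsymbol f; g=\{(\boldsymbol x,z)\in X^{n+1} : \exists \boldsymbol y\in X^n,\ (\boldsymbol x,y_i)\in f_i \text{ for each } i \text{ and } (\boldsymbol y,z)\in g\}$, $\mathsf A_i(f)=\{(\boldsymbol x,x_i)\in X^{n+1} : x_1,\dots,x_n \text{ all } E\text{-equivalent and there is no } y\in X \text{ with } (\boldsymbol x,y)\in f\}$, $\mathsf F_i(f)=\{(\boldsymbol x,x_i)\in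 X^{n+1} : (\boldsymbol x,x_i)\in f\}$ (fixset). An algebra is representable by injective $n$-ary partial functions if it is isomorphic to an algebra of $n$-ary partial functions of the same signature all of whose elements are injective. Notation: a bold symbol $\boldsymbol a$ in a term $\boldsymbol a; b$ stands for $\langle a_1,\dots,a_n\rangle$; unbracketed compositions associate to the right ($\boldsymbol a;\boldsymbol b; c=\boldsymbol a;(\boldsymbol b; c)$); for unary operations $\mathsf B_1,\dots,\mathsf B_n$, $\langle \mathsf B_1^n a\rangle$ means $\langle \mathsf B_1 a,\dots,\mathsf B_n a\rangle$. Abbreviations: $0:=\langle \mathsf A_1^n b\rangle; b$ for any $b$; $\pi_i:=\mathsf A_i 0$; $\boldsymbol\pi:=\langle\pi_1,\dots,\pi_n\rangle$; $\mathsf D_i a:=\mathsf A_i\mathsf A_i a$. *)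

(* Defs.v *)
From mathcomp Require Import all_boot.
From mathcomp Require Import boolp classical_sets functions.
From Stdlib Require Import RelationClasses.
From Stdlib Require List.

Set Implicit Arguments.
Unset Strict Implicit.
Unset Printing Implicit Defensive.

Local Open Scope classical_set_scope.

(* Indices 1, ..., n are the ordinals 'I_n, and X^n is 'I_n -> X. *)

Record algebra (n : nat) : Type := Algebra {
  carrier :> Type;
  comp : ('I_n -> carrier) -> carrier -> carrier;
  anti : 'I_n -> carrier -> carrier;
  fixs : 'I_n -> carrier -> carrier;
  carrier_inhabited : inhabited carrier
}.

Section PartialFunctions.
Variables (n : nat) (X : Type).

Definition nrel := set (('I_n -> X) * X).

Definition is_pfun (f : nrel) : Prop :=
  forall x y z, f (x, y) -> f (x, z) -> y = z.

Definition is_injective (f : nrel) : Prop :=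
  forall x y z, f (x, z) -> f (y, z) -> x = y.

Variable E : X -> X -> Prop.

Definition within (f : nrel) : Prop :=
  forall x y, f (x, y) ->
    (forall i j, E (x i) (x j)) /\ (forall i, E (x i) y).

Definition pfcomp (f : 'I_n -> nrel) (g : nrel) : nrel :=
  [set p | exists y : 'I_n -> X, (forall i, f i (p.1, y i)) /\ g (y, p.2)].

Definition pfanti (i : 'I_n) (f : nrel) : nrel :=
  [set p | [/\ p.2 = p.1 i, forall j k, E (p.1 j) (p.1 k)
             & ~ exists y, f (p.1, y)]].

Definition pffix (i : 'I_n) (f : nrel) : nrel :=
  [set p | p.2 = p.1 i /\ f p].

(* S is (the universe of) an algebra of n-ary partial functions with base X
   and equivalence relation E. *)
Definition pfun_algebra (S : set nrel) : Prop :=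
  [/\ Equivalence E,
      S !=set0,
      forall f, S f -> is_pfun f /\ within f,
      forall f g, (forall i, S (f i)) -> S g -> S (pfcomp f g)
    & forall i f, S f -> S (pfanti i f) /\ S (pffix i f)].

Definition isomorphism (A : algebra n) (S : set nrel) (h : A -> nrel) : Prop :=
  [/\ set_bij [set: A] S h,
      forall a b, h (comp a b) = pfcomp (fun i => h (a i)) (h b),
      forall i a, h (anti i a) = pfanti i (h a)
    & forall i a, h (fixs i a) = pffix i (h a)].

End PartialFunctions.

Definition injectively_representable (n : nat) (A : algebra n) : Prop :=
  exists (X : Type) (E : X -> X -> Prop) (S : set (nrel n X)) (h : A -> nrel n X),
    [/\ pfun_algebra E S,
        forall f, S f -> is_injective f
      & isomorphism E S h].

Inductive term (n : nat) : Type :=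
| Var of nat
| Comp of ('I_n -> term n) & term n
| Anti of 'I_n & term n
| Fixs of 'I_n & term n.
Arguments Var {n}.

Fixpoint eval (n : nat) (A : algebra n) (v : nat -> A) (t : term n) : A :=
  match t with
  | Var k => v k
  | Comp s u => comp (fun i => eval v (s i)) (eval v u)
  | Anti i u => anti i (eval v u)
  | Fixs i u => fixs i (eval v u)
  end.

Record equation (n : nat) : Type := Eqn { lhs : term n; rhs : term n }.

Record quasieq (n : nat) : Type :=
  QuasiEq { premises : seq (equation n); conclusion : equation n }.

Definition eqn_holds (n : nat) (A : algebra n) (v : nat -> A) (e : equation n) :=
  eval v (lhs e) = eval v (rhs e).

Definition satisfies (n : nat) (A : algebra n) (q : quasieq n) : Prop :=
  forall v : nat -> A,
    (forall e, List.In e (premises q) -> eqn_holds v e) ->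
    eqn_holds v (conclusion q).

Definition axiomatised_by (n : nat) (K : algebra n -> Prop) (Q : set (quasieq n)) :=
  forall A : algebra n, K A <-> (forall q, Q q -> satisfies A q).

Definition is_quasivariety (n : nat) (K : algebra n -> Prop) : Prop :=
  exists Q : set (quasieq n), axiomatised_by K Q.

Declare Scope pterm_scope.
Delimit Scope pterm_scope with pterm.
Notation "s ;; t" := (Comp s t) (at level 60, right associativity) : pterm_scope.
Notation "s =~ t" := (Eqn s t) (at level 70, no associativity) : pterm_scope.
Local Open Scope pterm_scope.

Section QuasiEquations.
Variable n : nat.
Implicit Types (t : term n) (s : 'I_n -> term n) (i j k : 'I_n).

(* Pairwise distinct variables: n each for the tuples a, b, c, then the single
   elements a, b, c, and the variable o used to write the constant 0. *)
Let va : 'I_n -> term n := fun i => Var i.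
Let vb : 'I_n -> term n := fun i => Var (n + i).
Let vc : 'I_n -> term n := fun i => Var (2 * n + i).
Let a : term n := Var (3 * n).
Let b : term n := Var (3 * n + 1).
Let c : term n := Var (3 * n + 2).
Let o : term n := Var (3 * n + 3).

Definition tA t : 'I_n -> term n := fun i => Anti i t.
Definition tD t : 'I_n -> term n := fun i => Anti i (Anti i t).

(* 0 is <A_1 o, ..., A_n o> ; o: since o occurs nowhere else, the equation
   <A_1 a, ..., A_n a> ; a = 0 in the list below says that this value does not
   depend on the choice of o. *)
Definition tzero : term n := tA o ;; o.
Definition tpi : 'I_n -> term n := fun i => Anti i tzero.

(* <D_1^n s_1> ; ... ; <D_1^n s_n> ; t, associated to the right *)
Definition tDs s t : term n := foldr (fun j u => tD (s j) ;; u) t (enum 'I_n).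

Definition subst_at s i t : 'I_n -> term n := fun j => if j == i then t else s j.

Definition identity (e : equation n) : quasieq n := QuasiEq [::] e.

Definition axioms : seq (quasieq n) :=
  [:: identity ((fun i => va ;; vb i) ;; c =~ va ;; vb ;; c);
      identity (tpi ;; a =~ a);
      identity (tA a ;; a =~ tzero)] ++
  [seq identity (subst_at va i tzero ;; b =~ tzero) | i <- enum 'I_n] ++
  [:: identity (va ;; tzero =~ tzero)] ++
  [seq identity (va ;; Anti i b =~ tA (va ;; b) ;; tDs va (va i))
    | i <- enum 'I_n] ++
  [:: QuasiEq [:: tD a ;; b =~ tD a ;; c; tA a ;; b =~ tA a ;; c] (b =~ c);
      identity (tD a ;; a =~ a)] ++
  [seq identity (Anti p.1.1 (Anti p.1.2 a) =~ Anti p.1.1 (Anti p.2 a))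
    | p <- enum {: 'I_n * 'I_n * 'I_n}] ++
  [seq QuasiEq [:: vb ;; a =~ vc ;; a] (vb ;; tD a i =~ vc ;; tD a i)
    | i <- enum 'I_n] ++
  [seq identity (tD (Fixs i a) i =~ Fixs i a) | i <- enum 'I_n] ++
  [seq identity (tD (Fixs i a) ;; a =~ Fixs i a) | i <- enum 'I_n] ++
  [seq QuasiEq [:: vb ;; a =~ vb i] (vb ;; Fixs i a =~ vb i) | i <- enum 'I_n].

End QuasiEquations.

(* Main.v *)
Require Import Defs.
From mathcomp Require Import all_boot.
From Stdlib Require List.
From mathcomp Require Import boolp classical_sets functions.

Set Implicit Arguments.
Unset Strict Implicit.
Unset Printing Implicit Defensive.

Local Open Scope classical_set_scope.
Local Notation "a ;; b" := (Defs.comp a b).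

(** The quasiequations are valid because each of them, read in terms of domains
and values of partial functions, is evident once two derived operations are
understood: [dres d x] restricts [x] to the domain of [d], and [ares d x] to
its complement.  Injectivity enters through the cancellation law: if
[a ;; x] and [b ;; x] are the same function then, where it is defined, the
tuples [a] and [b] have the same image under the injective [x], so they agree.

Conversely let [A] satisfy the quasiequations.  Domains behave like a Boolean
algebra acting on [A]: the maps [dres d] are idempotent, commute ([dresC]),
compose as [dresA] says, and have [ares d] as complement, in the sense that
two elements with the same restriction to [d] and off [d] are equal.  Call a
set [F] of elements an ultrafilter if it consists of all elements whose
domains belong to one ultrafilter of domains.  It identifies elements [x]
and [y] having the same restriction to some member of [F]; the classes are
the germs at [F].  The points of the base are the germs at [F] of members of
[F], for all [F] together, and two points are equivalent when they live at
the same ultrafilter.  An element [x] sends the tuple of germs of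
[a 1, ..., a n] to the germ of [a ;; x], if [a ;; x] is in [F].

This is compatible with composition by associativity ([rep_comp]), and with
antidomains because [a ;; anti i x] is [a i] restricted to the domains of all
the [a j] and off the domain of [a ;; x] ([rep_anti]).  The laws of fixsets
ensure that [a ;; fixs i x] has the germ of [a i] whenever [a ;; x] has it, and
conversely that, if [a ;; fixs i x] is in [F], its germ is both that of [a ;; x]
and that of [a i] ([rep_fixs]).  Cancellation turns an equality of the germs
of [a ;; x] and [b ;; x] into one of the germs of [a ;; dom i x] and
[b ;; dom i x], which are those of [a i] and [b i]: so every element acts
injectively ([rep_injective]).  Finally, by Zorn's lemma, two
distinct elements [x] and [y] have distinct germs at some ultrafilter
([ultra_separates]); there they act differently on the tuple of germs of the
projections, which they send to their own germs ([rep_inj]). *)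

(** * The quasiequations as laws on elements *)

Section Restrictions.
Variables (n : nat) (A : algebra n).
Implicit Types (a b : 'I_n -> A) (x y z d : A) (i j k : 'I_n).

Definition dom i x : A := anti i (anti i x).

(** The tuple [dom i d] consists of the projections restricted to the domain of
[d]; composing it with [x] therefore restricts [x] to that domain. *)
Definition dres d x : A := (fun i => dom i d) ;; x.

Definition ares d x : A := (fun i => anti i d) ;; x.
Definition dres_all a x : A := foldr (fun j => dres (a j)) x (enum 'I_n).

(** The constant zero appears as [ares o o] for an arbitrary [o]; that its value
does not depend on [o] is [ares_diag]. *)
Record laws : Prop := Laws {
  comp_assoc : forall a b x, (fun i => a ;; b i) ;; x = a ;; (b ;; x);
  proj_comp : forall o x, (fun i => anti i (ares o o)) ;; x = x;
  ares_diag : forall x o, ares x x = ares o o;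
  comp_subst0 : forall o a i x,
    (fun j => if j == i then ares o o else a j) ;; x = ares o o;
  comp0 : forall o a, a ;; ares o o = ares o o;
  comp_anti : forall a x i, a ;; anti i x = ares (a ;; x) (dres_all a (a i));
  dres_ares_eq : forall d x y,
    dres d x = dres d y -> ares d x = ares d y -> x = y;
  dres_diag : forall x, dres x x = x;
  anti_anti : forall x i j k, anti i (anti j x) = anti i (anti k x);
  comp_cancel : forall a b x i, a ;; x = b ;; x -> a ;; dom i x = b ;; dom i x;
  dom_fixs : forall x i, dom i (fixs i x) = fixs i x;
  dres_fixs : forall x i, dres (fixs i x) x = fixs i x;
  comp_fixs : forall a x i, a ;; x = a i -> a ;; fixs i x = a i
}.

End Restrictions.

Section AxiomsAsLaws.
Variables (n : nat).

Definition holds_all (A : algebra n) (Q : seq (quasieq n)) :=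
  forall q, List.In q Q -> satisfies A q.

Lemma holds_all_cat (A : algebra n) Q R :
  holds_all A (Q ++ R) <-> holds_all A Q /\ holds_all A R.
Proof.
rewrite /holds_all; elim: Q => [|q Q IH] /=; first by split=> // -[].
split=> [H|[H1 H2] r [<-|Hr]]; last 2 first.
- by apply: H1; left.
- by apply: (proj2 IH) => //; split=> // s Hs; apply: H1; right.
have [H1 H2] : (forall q, List.In q Q -> satisfies A q) /\
               (forall q, List.In q R -> satisfies A q).
  by apply/IH => r Hr; apply: H; right.
by split=> // r [<-|]; [apply: H; left | apply: H1].
Qed.

Lemma holds_all_map (A : algebra n) (T : finType) (f : T -> quasieq n) :
  holds_all A [seq f t | t <- enum T] <-> forall t, satisfies A (f t).
Proof.
have : holds_all A [seq f t | t <- enum T] <->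
       forall t, t \in enum T -> satisfies A (f t).
  elim: (enum T) => [|t s IH] /=; first by split=> // _ q [].
  split=> [H u|H q [<-|Hq]]; last 2 first.
  - by apply: H; rewrite mem_head.
  - by apply: (proj2 IH) => // u us; apply: H; rewrite inE us orbT.
  rewrite inE => /orP [/eqP ->|us]; first by apply: H; left.
  by apply: (proj1 IH) => // q Hq; apply: H; right.
by case=> H1 H2; split=> [/H1 H t|H]; [apply: H; rewrite mem_enum | apply: H2].
Qed.

Lemma holds_all_cons (A : algebra n) q Q :
  holds_all A (q :: Q) <-> satisfies A q /\ holds_all A Q.
Proof.
split=> [H|[H1 H2] r [<-|Hr]] //; last exact: H2.
by split=> [|r Hr]; apply: H; [left | right].
Qed.

(** The variables of the quasiequations lie in three blocks of [n] indices
followed by four single ones, so they can be given arbitrary values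
independently of each other. *)
Lemma assignment_exists (A : algebra n) (p q r : 'I_n -> A) (x y z o : A) :
  exists2 v : nat -> A,
    [/\ (fun i : 'I_n => v i) = p, (fun i : 'I_n => v (n + i)) = q
      & (fun i : 'I_n => v (2 * n + i)) = r] &
    [/\ v (3 * n) = x, v (3 * n + 1) = y, v (3 * n + 2) = z
      & v (3 * n + 3) = o].
Proof.
pose v k := if insub k is Some i then p i else
            if insub (k - n) is Some i then q i else
            if insub (k - 2 * n) is Some i then r i else
            nth o [:: x; y; z] (k - 3 * n).
have big k : n <= k -> (insub k : option 'I_n) = None.
  by move=> nk; rewrite insubN // -leqNgt.
have v3 k : v (3 * n + k) = nth o [:: x; y; z] k.
  have tn : 3 * n = n + n + n by rewrite !mulSn mul0n addn0 addnA.
  have dn : 2 * n = n + n by rewrite !mulSn mul0n addn0.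
  rewrite /v !big ?addKn // tn ?dn.
  - by rewrite -!addnA addnA addKn leq_addr.
  - by rewrite -[n + n + n]addnA -addnA addKn -addnA leq_addr.
  - by rewrite -!addnA leq_addr.
exists v; last by rewrite -[in LHS](addn0 (3 * n)) !v3.
have dn : 2 * n = n + n by rewrite !mulSn mul0n addn0.
split; apply: funext => i; rewrite /v ?dn.
- by rewrite valK.
- by rewrite big ?leq_addr // addKn valK.
- by rewrite !(big (_ + i)) ?(big (_ + i - n)) -?addnA ?addKn ?leq_addr //
    addnA addKn valK.
Qed.

Lemma eval_tDs (A : algebra n) (v : nat -> A) s t :
  eval v (tDs s t) = dres_all (fun i => eval v (s i)) (eval v t).
Proof. by rewrite /tDs /dres_all; elim: (enum _) => //= j e ->. Qed.

Lemma axioms_laws (A : algebra n) : holds_all A (axioms n) <-> laws A.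
Proof.
rewrite /axioms !(holds_all_cat, holds_all_cons, holds_all_map).
rewrite /satisfies /eqn_holds /=.
(* an identity is a quasiequation with no premises *)
have none v : forall e : equation n, False ->
    eval (A := A) v (lhs e) = eval v (rhs e).
  by move=> e [].
split.
- case=> [[K1 [K2 [K3 _]]] [K4 [[K5 _] [K6 [[K7 [K8 _]]]]]]].
  case=> [K9 [K10 [K11 [K12 K13]]]].
  split.
  + move=> p q x; have [v [<- <- _] [_ _ <- _]] :=
      assignment_exists p q q x x x x.
    exact: K1.
  + move=> o x; have [v _ [<- _ _ <-]] :=
      assignment_exists (fun=> x) (fun=> x) (fun=> x) x x x o.
    exact: K2.
  + move=> x o; have [v _ [<- _ _ <-]] :=
      assignment_exists (fun=> x) (fun=> x) (fun=> x) x x x o.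
    exact: K3.
  + move=> o p t x; have [v [<- _ _] [_ <- _ <-]] :=
      assignment_exists p p p x x x o.
    apply: (eq_trans _ (K4 t v (none v))); congr (_ ;; _); apply: funext => j.
    by rewrite /subst_at; case: (j == t).
  + move=> o p; have [v [<- _ _] [_ _ _ <-]] :=
      assignment_exists p p p o o o o.
    exact: K5.
  + move=> p x t; have [v [<- _ _] [_ <- _ _]] :=
      assignment_exists p p p x x x x.
    by apply: (eq_trans (K6 t v (none v))); rewrite eval_tDs.
  + move=> d x y; have [v _ [<- <- <- _]] :=
      assignment_exists (fun=> x) (fun=> x) (fun=> x) d x y x.
    by move=> ed ea; apply: K7 => e [<-|[<-|//]].
  + move=> x; have [v _ [<- _ _ _]] :=
      assignment_exists (fun=> x) (fun=> x) (fun=> x) x x x x.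
    exact: K8.
  + move=> x i j k; have [v _ [<- _ _ _]] :=
      assignment_exists (fun=> x) (fun=> x) (fun=> x) x x x x.
    exact: (K9 (i, j, k)).
  + move=> p q x t; have [v [_ <- <-] [<- _ _ _]] :=
      assignment_exists p p q x x x x.
    by move=> epq; apply: K10 => e [<-|//].
  + move=> x t; have [v _ [<- _ _ _]] :=
      assignment_exists (fun=> x) (fun=> x) (fun=> x) x x x x.
    exact: K11.
  + move=> x t; have [v _ [<- _ _ _]] :=
      assignment_exists (fun=> x) (fun=> x) (fun=> x) x x x x.
    exact: K12.
  + move=> p x t; have [v [_ <- _] [<- _ _ _]] :=
      assignment_exists p p p x x x x.
    by move=> ep; apply: K13 => e [<-|//].
- move=> L; split; [split; [|split; [|split]] | split; [|split; [split|split;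
    [|split; [split; [|split]|split; [|split; [|split; [|split]]]]]]]] => //.
  + by move=> v _; apply: comp_assoc.
  + by move=> v _; apply: proj_comp.
  + by move=> v _; apply: ares_diag.
  + move=> t v _; apply: (eq_trans _ (comp_subst0 L _ (fun i => v i) t _)).
    congr (_ ;; _); apply: funext => j; rewrite /subst_at.
    by case: (j == t).
  + by move=> v _; apply: comp0.
  + by move=> t v _; rewrite eval_tDs; apply: comp_anti.
  + move=> v H; apply: (dres_ares_eq L (d := v (3 * n))).
      exact: (H _ (or_introl erefl)).
    exact: (H _ (or_intror (or_introl erefl))).
  + by move=> v _; apply: dres_diag.
  + by move=> [[i j] k] v _; apply: anti_anti.
  + by move=> t v H; apply: comp_cancel => //; apply: (H _ (or_introl erefl)).
  + by move=> t v _; apply: dom_fixs.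
  + by move=> t v _; apply: dres_fixs.
  + move=> t v H; apply: (comp_fixs L (a := fun i => v (n + i))) => //.
    exact: (H _ (or_introl erefl)).
Qed.
End AxiomsAsLaws.

(** * Algebras of injective partial functions satisfy the laws *)

Section Soundness.
Variables (n : nat) (i0 : 'I_n) (A : algebra n) (X : Type) (E : X -> X -> Prop).
Variables (S : set (nrel n X)) (h : A -> nrel n X).
Hypotheses (algS : pfun_algebra E S) (injS : forall f, S f -> is_injective f).
Hypothesis isoh : isomorphism E S h.
Implicit Types (a b : 'I_n -> A) (x y z d : A) (i j k : 'I_n).

Let hS x : S (h x).
Proof. by case: isoh => -[+ _ _] _ _ _; apply. Qed.

Let h_ext x y : (forall p q, h x (p, q) <-> h y (p, q)) -> x = y.
Proof.
case: isoh => -[_ + _] _ _ _ xy; apply; rewrite ?in_setT //.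
by apply/seteqP; split=> -[p q] /xy.
Qed.

Let h_comp a x p q :
  h (a ;; x) (p, q) <-> exists r, (forall i, h (a i) (p, r i)) /\ h x (r, q).
Proof. by case: isoh => _ -> _ _. Qed.

Let h_anti i x p q : h (anti i x) (p, q) <->
  [/\ q = p i, forall j k, E (p j) (p k) & ~ exists w, h x (p, w)].
Proof. by case: isoh => _ _ -> _. Qed.

Let h_fixs i x p q : h (fixs i x) (p, q) <-> q = p i /\ h x (p, q).
Proof. by case: isoh => _ _ _ ->. Qed.

Let h_pfun x p q r : h x (p, q) -> h x (p, r) -> q = r.
Proof. by case: algS => _ _ /(_ _ (hS x)) [+ _] _ _; apply. Qed.

Let h_args x p q i j : h x (p, q) -> E (p i) (p j).
Proof.
by case: algS => _ _ /(_ _ (hS x)) [_ +] _ _ => /[apply] -[+ _]; apply.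
Qed.

Let h_val x p q i : h x (p, q) -> E (p i) q.
Proof.
by case: algS => _ _ /(_ _ (hS x)) [_ +] _ _ => /[apply] -[_]; apply.
Qed.

Let h_dom i x p q : h (dom i x) (p, q) <-> q = p i /\ exists w, h x (p, w).
Proof.
rewrite h_anti; split=> [[-> Ep nA]|[-> [w xw]]].
  split=> //; apply: contrapT => nx; apply: nA; exists (p i).
  by rewrite h_anti.
split=> // [j k|[q']]; first exact: h_args xw.
by rewrite h_anti => -[_ _]; apply; exists w.
Qed.

Let h_dres d x p q :
  h (dres d x) (p, q) <-> (exists w, h d (p, w)) /\ h x (p, q).
Proof.
rewrite h_comp; split=> [[r [rp xr]]|[dp xp]].
  have rP i := proj1 (h_dom i d p (r i)) (rp i).
  have rp_eq : r = p by apply: funext => i; case: (rP i).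
  by split; [case: (rP i0) | rewrite -rp_eq].
by exists p; split=> // i; rewrite h_dom.
Qed.

Let h_ares d x p q :
  h (ares d x) (p, q) <-> ~ (exists w, h d (p, w)) /\ h x (p, q).
Proof.
rewrite h_comp; split=> [[r [rp xr]]|[dp xp]].
  have rP i := proj1 (h_anti i d p (r i)) (rp i).
  have rp_eq : r = p by apply: funext => i; case: (rP i).
  by split; [case: (rP i0) | rewrite -rp_eq].
by exists p; split=> // i; rewrite h_anti; split=> // j k; apply: h_args xp.
Qed.

Let h_dres_all a x p q : h (dres_all a x) (p, q) <->
  (forall i, exists w, h (a i) (p, w)) /\ h x (p, q).
Proof.
suff -> : h (dres_all a x) (p, q) <->
  (forall i, i \in enum 'I_n -> exists w, h (a i) (p, w)) /\ h x (p, q).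
  by split=> -[ap xp]; split=> // i *; apply: ap; rewrite ?mem_enum.
rewrite /dres_all; elim: (enum _) => [|j s IH] /=; first by split=> // -[].
rewrite h_dres IH; split=> [[ajp [ap xp]]|[ap xp]].
  by split=> // i; rewrite inE => /orP [/eqP ->|/ap].
split; first by apply: ap; rewrite mem_head.
by split=> // i si; apply: ap; rewrite inE si orbT.
Qed.

Let h_zero o p q : ~ h (ares o o) (p, q).
Proof. by rewrite h_ares => -[+ oq]; apply; exists q. Qed.

Lemma representable_laws : laws A.
Proof.
split.
- move=> a b x; apply: h_ext => p q; rewrite !h_comp; split.
    case=> r [/(_ _)/(proj1 (h_comp _ _ _ _)) abr xr].
    (* The intermediate tuple of [a] given by each component is the same,
       because the [a j] are functional. *)
    have [s [as_ _]] := abr i0.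
    exists s; split=> //; rewrite h_comp; exists r; split=> // i.
    have [s' [as' br]] := abr i.
    by have -> : s = s' by apply: funext => j; apply: h_pfun (as_ j) (as' j).
  case=> s [as_]; rewrite h_comp => -[r [br xr]]; exists r; split=> // i.
  by rewrite h_comp; exists s.
- move=> o x; apply: h_ext => p q; rewrite h_comp; split=> [[r [pr xr]]|xp].
    have -> // : p = r.
    by apply: funext => i; case: (proj1 (h_anti i _ p _) (pr i)).
  exists p; split=> // i; rewrite h_anti; split=> // [j k|[w /h_zero //]].
  exact: h_args xp.
- by move=> x o; apply: h_ext => p q; split=> /h_zero.
- move=> o a i x; apply: h_ext => p q; rewrite h_comp.
  by split=> [[r [/(_ i)]]|/h_zero //]; rewrite eqxx => /h_zero.
- move=> o a; apply: h_ext => p q; rewrite h_comp.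
  by split=> [[r [_ /h_zero]]|/h_zero].
- move=> a x i; apply: h_ext => p q; rewrite h_ares h_dres_all h_comp.
  split=> [[r [ar]]|[nx [/choice [r ar] aq]]].
    rewrite h_anti => -[-> Er nx]; split; last first.
      by split=> // j; exists (r j).
    case=> w; rewrite h_comp => -[s [as_ xs]]; apply: nx; exists w.
    by have -> : r = s by apply: funext => j; apply: h_pfun (ar j) (as_ j).
  exists r; split=> //; rewrite h_anti; split.
  + exact: h_pfun aq (ar i).
  + case: algS => -[_ Esym Etrans] _ _ _ _ j k.
    apply: Etrans (h_val k (ar k)).
    by apply: Esym; apply: h_val (ar j).
  + by case=> w xw; apply: nx; exists w; rewrite h_comp; exists r.
- move=> d x y edx eax; apply: h_ext => p q.
  case: (pselect (exists w, h d (p, w))) => dp.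
    by have := h_dres d x p q; rewrite edx h_dres => H; tauto.
  by have := h_ares d x p q; rewrite eax h_ares => H; tauto.
- move=> x; apply: h_ext => p q; rewrite h_dres; split=> [[] //|xq].
  by split=> //; exists q.
- have aux x i j k p q :
      h (anti i (anti j x)) (p, q) -> h (anti i (anti k x)) (p, q).
    rewrite !h_anti => -[-> Ep nx]; split=> // -[w].
    rewrite h_anti => -[_ _ nx']; apply: nx; exists (p j).
    by rewrite h_anti.
  by move=> x i j k; apply: h_ext => p q; split; apply: aux.
- move=> a b x i ab; apply: h_ext => p q; rewrite !h_comp.
  suff aux c c' : c ;; x = c' ;; x ->
      forall r, (forall i, h (c i) (p, r i)) -> h (dom i x) (r, q) ->
      exists r, (forall i, h (c' i) (p, r i)) /\ h (dom i x) (r, q).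
    by split=> -[r [ar xr]]; apply: aux (ar) xr.
  move=> cc' r cr xr; exists r; split=> //.
  move: xr; rewrite h_dom => -[_ [w xw]].
  have : h (c' ;; x) (p, w) by rewrite -cc' h_comp; exists r.
  rewrite h_comp => -[r' [c'r xr']].
  (* [x] takes the value [w] at both [r] and [r'] *)
  by have -> : r = r' by apply: injS (hS x) _ _ _ xw xr'.
- move=> x i; apply: h_ext => p q; rewrite h_dom h_fixs.
  split=> [[-> [w]]|[-> xp]]; first by rewrite h_fixs => -[-> ].
  by split=> //; exists (p i); rewrite h_fixs.
- move=> x i; apply: h_ext => p q; rewrite h_dres h_fixs.
  split=> [[[w]]|[-> xp]].
    by rewrite h_fixs => -[-> xp] /(h_pfun xp) <-.
  by split=> //; exists (p i); rewrite h_fixs.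
- move=> a x i eax; apply: h_ext => p q; rewrite h_comp.
  split=> [[r [ar]]|aq]; first by rewrite h_fixs => -[-> _].
  have := aq; rewrite -{1}eax h_comp => -[r [ar xr]]; exists r; split=> //.
  by rewrite h_fixs; split=> //; apply: h_pfun aq (ar i).
Qed.

End Soundness.

(** * Boolean calculus of domain restrictions *)

Section Completeness.
Variables (n : nat) (i0 : 'I_n) (A : algebra n) (o : A).
Hypothesis L : laws A.
Implicit Types (F : set A) (a b : 'I_n -> A) (x y z c d e : A) (i j k : 'I_n).

Local Notation zero := (ares o o).
Local Notation proj i := (anti i zero).

Lemma ares_diag0 x : ares x x = zero.
Proof. exact: ares_diag. Qed.

Lemma dres_compA d a x : dres d (a ;; x) = (fun i => dres d (a i)) ;; x.
Proof. by rewrite /dres (comp_assoc L). Qed.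

Lemma ares_compA d a x : ares d (a ;; x) = (fun i => ares d (a i)) ;; x.
Proof. by rewrite /ares (comp_assoc L). Qed.

Lemma comp_const0 a x i : a i = zero -> a ;; x = zero.
Proof.
move=> ai0; rewrite -(comp_subst0 L o a i x); congr (_ ;; _).
by apply: funext => j; case: eqP => [->|].
Qed.

Lemma dres_zero d : dres d zero = zero.
Proof. exact: comp0. Qed.

Lemma zero_ares x : ares zero x = x.
Proof. exact: proj_comp. Qed.

Lemma dom_anti_const i j k x : dom k (anti i x) = dom k (anti j x).
Proof. by rewrite /dom (anti_anti L x k i j). Qed.

Lemma dres_all_id a x : (forall i, dres (a i) x = x) -> dres_all a x = x.
Proof.
by move=> ax; rewrite /dres_all; elim: (enum _) => //= j s ->.
Qed.

Lemma comp_proj a i : a ;; proj i = dres_all a (a i).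
Proof. by rewrite comp_anti // comp0 // zero_ares. Qed.

Lemma dres_antiE i j x y : dres (anti i x) y = dres (anti j x) y.
Proof.
by congr (_ ;; _); apply: funext => k; apply: dom_anti_const.
Qed.

(** The law for composition with an antidomain restricts to the domains of a
whole tuple.  On tuples of antidomains of a single element this has no effect, and
the simpler laws [ares_anti] and [dres_anti] result. *)
Lemma dres_all_anti x j : dres_all (fun i => anti i x) (anti j x) = anti j x.
Proof.
by apply: dres_all_id => i; rewrite (dres_antiE i j) dres_diag.
Qed.

Lemma ares_proj x j : ares x (proj j) = anti j x.
Proof. by rewrite /ares comp_proj dres_all_anti. Qed.

Lemma anti_proj i j : anti i (proj j) = zero.
Proof.
rewrite (anti_anti L zero i j i) -(ares_proj (proj i) i).
exact: ares_diag0.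
Qed.

Lemma dres_proj j x : dres (proj j) x = x.
Proof.
rewrite -[RHS](proj_comp L o) /dres; congr (_ ;; _).
by apply: funext => i; rewrite /dom anti_proj.
Qed.

Lemma ares_anti x y j : ares x (anti j y) = ares (ares x y) (anti j x).
Proof. by rewrite {1}/ares comp_anti // dres_all_anti. Qed.

Lemma ares_anti_diag x j : ares x (anti j x) = anti j x.
Proof. by rewrite ares_anti ares_diag0 zero_ares. Qed.

Lemma aresN x y k : ares (anti k x) y = dres x y.
Proof.
by congr (_ ;; _); apply: funext => i; rewrite /dom (anti_anti L x i i k).
Qed.

Lemma dres_anti x y j : dres x (anti j y) = ares (dres x y) (dom j x).
Proof. by rewrite -!(aresN x _ j) ares_anti. Qed.

Lemma dres_anti_diag x j : dres x (anti j x) = zero.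
Proof. by rewrite -(aresN _ _ j) ares_diag0. Qed.

Lemma ares_dom_diag x j : ares x (dom j x) = zero.
Proof. by rewrite /dom ares_anti ares_anti_diag ares_diag0. Qed.

(** Triple antidomain is antidomain: on the domain of [x] both sides vanish, and
off it both are the projection. *)
Lemma anti_dom i j x : anti i (dom j x) = anti i x.
Proof.
rewrite /dom (anti_anti L (anti j x) i j i).
have -> : anti i (anti i (anti j x)) = dom i (anti i x).
  exact: dom_anti_const.
apply: (dres_ares_eq L (d := x)).
  rewrite dres_anti_diag -(aresN x _ i).
  exact: ares_dom_diag.
rewrite ares_anti_diag /dom ares_anti ares_dom_diag.
exact: zero_ares.
Qed.

Lemma dom_anti i j x : dom i (anti j x) = anti i x.
Proof. by rewrite -(anti_dom i j x) /dom (anti_anti L (anti j x) i j i). Qed.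

Lemma dresN i x y : dres (anti i x) y = ares x y.
Proof. by congr (_ ;; _); apply: funext => j; apply: dom_anti. Qed.

Lemma dres_dom_diag j x : dres x (dom j x) = dom j x.
Proof. by rewrite /dom -(aresN _ _ j) ares_anti_diag. Qed.

Lemma dres_dresK d x : dres d (dres d x) = dres d x.
Proof.
rewrite -{1 2}[dres d x]/(_ ;; x) dres_compA; congr (_ ;; _).
by apply: funext => i; apply: dres_dom_diag.
Qed.

Lemma ares_dres0 d x : ares d (dres d x) = zero.
Proof.
rewrite -[dres d x]/(_ ;; x) ares_compA (@comp_const0 _ _ i0) //.
exact: ares_dom_diag.
Qed.

(** Both sides vanish off the domain of [x]; on it, the double antidomain of
[dres x y] unfolds by two uses of [dres_anti] to that of [y]. *)
Lemma dom_dres j x y : dom j (dres x y) = dres x (dom j y).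
Proof.
apply: (dres_ares_eq L (d := x)).
  rewrite dres_dresK /dom dres_anti [in LHS]dres_anti dres_dresK -dres_anti.
  by rewrite -dres_anti.
rewrite ares_dres0 /dom ares_anti [ares x (anti _ _)]ares_anti ares_dres0.
by rewrite zero_ares ares_diag0.
Qed.

Lemma dresA x y z : dres (dres x y) z = dres x (dres y z).
Proof.
rewrite -[dres y z]/(_ ;; z) dres_compA.
by congr (_ ;; _); apply: funext => j; rewrite dom_dres.
Qed.

Lemma zero_dres x : dres zero x = zero.
Proof.
by rewrite /dres (@comp_const0 _ _ i0) //; apply: anti_proj.
Qed.

(** By [dres_diag] the left side [v] equals [dres v v].  With x' for the
complement of x, this is the product x y x' x y x', which vanishes because x' x does. *)
Lemma dres_dres_anti0 x y j : dres (dres x y) (anti j x) = zero.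
Proof.
set v := dres _ _.
have vx : dres v x = zero.
  by rewrite /v dresA dresN ares_diag0 dres_zero.
by rewrite -(dres_diag L v) {2}/v dresA -dresA vx zero_dres.
Qed.

Lemma dres_dres_dom x y j : dres (dres x y) (dom j x) = dres x (dom j y).
Proof.
by rewrite /dom dres_anti dres_dres_anti0 zero_ares; exact: dom_dres.
Qed.

(** Compare on the domain of [y] and off it.  On it both sides become [dom j x]
restricted to [y].  Off it the right side vanishes, and the left side is
[dom j y] restricted to a domain contained in the complement of [y]. *)
Lemma dres_domC x y j : dres x (dom j y) = dres y (dom j x).
Proof.
apply: (dres_ares_eq L (d := y)).
  by rewrite dres_dresK -dresA dres_dres_dom.
rewrite ares_dres0 -(dresN j) -dresA {1}/dom dres_anti.
have := dres_dres_dom (anti j y) x j.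
rewrite dom_anti -dom_dres => ->.
exact: ares_diag0.
Qed.

Lemma dresC x y z : dres x (dres y z) = dres y (dres x z).
Proof.
rewrite -!dresA; congr (_ ;; _); apply: funext => j.
by rewrite !dom_dres dres_domC.
Qed.

Lemma dres_all_comp a b x :
  dres_all a (b ;; x) = (fun i => dres_all a (b i)) ;; x.
Proof.
rewrite /dres_all; elim: (enum _) => [|j s IH] //=.
by rewrite IH dres_compA.
Qed.

(** Write [x] as the tuple of projections composed with [x]: associativity then
replaces each [a i] by [a] composed with a projection, which is [a i]
restricted to the domains of all the [a j]. *)
Lemma comp_dres_all a x : dres_all a (a ;; x) = a ;; x.
Proof.
rewrite -{2}(proj_comp L o x) -(comp_assoc L) dres_all_comp.
by congr (_ ;; _); apply: funext => i; rewrite comp_proj.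
Qed.

Lemma dres_dres_all a x i : dres (a i) (dres_all a x) = dres_all a x.
Proof.
rewrite /dres_all; have := mem_enum 'I_n i; rewrite inE.
elim: (enum _) => //= j s IH; rewrite inE.
case: eqP => [->|_] /= si; first by rewrite dres_dresK.
by rewrite dresC IH.
Qed.

Lemma dres_comp_arg a x i : dres (a i) (a ;; x) = a ;; x.
Proof. by rewrite -comp_dres_all dres_dres_all. Qed.

(** * Ultrafilters of domains and germs *)

(** A filter of domains is represented by the set of all elements whose domain
belongs to it, so that no separate type of domains is required.  The equation
[dres e d = d] says that the domain of [d] is contained in that of [e].  The
empty set is admitted: it is the union of the empty chain in the use of
Zorn's lemma below. *)
Record is_filter F : Prop := IsFilter {
  filter_meet : forall d e, F d -> F e -> F (dres d e);
  filter_up : forall d e, dres e d = d -> F d -> F e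
}.

Record is_ultra F : Prop := IsUltra {
  ultra_filter : is_filter F;
  ultra_proj : forall i, F (proj i);
  ultra_proper : ~ F zero;
  ultra_or : forall x i, F x \/ F (anti i x)
}.

Definition germ_eq F x y := exists2 d, F d & dres d x = dres d y.

Section Filter.
Variable F : set A.
Hypothesis filF : is_filter F.

Lemma germ_sym x y : germ_eq F x y -> germ_eq F y x.
Proof. by case=> d Fd e; exists d. Qed.

Lemma germ_trans x y z : germ_eq F x y -> germ_eq F y z -> germ_eq F x z.
Proof.
case=> d Fd xy [e Fe yz]; exists (dres d e); first exact: filter_meet.
by rewrite !dresA dresC xy dresC yz.
Qed.

Lemma germ_dres d x : F d -> germ_eq F (dres d x) x.
Proof. by move=> Fd; exists d => //; rewrite dres_dresK. Qed.

Lemma germ_mem x y : germ_eq F x y -> F x -> F y.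
Proof.
case=> d Fd xy Fx; apply: (@filter_up _ filF (dres d y)).
  by rewrite dresC dres_diag.
by rewrite -xy; apply: filter_meet.
Qed.

Lemma filter_dresl d x : F (dres d x) -> F d.
Proof. by apply: filter_up => //; rewrite dres_dresK. Qed.

Lemma filter_dres_all a x : (forall i, F (a i)) -> F x -> F (dres_all a x).
Proof.
move=> Fa Fx; rewrite /dres_all; elim: (enum _) => [|j s IH] /=; first by [].
exact: (filter_meet filF (Fa j) IH).
Qed.

Lemma filter_comp_arg a x i : F (a ;; x) -> F (a i).
Proof. exact: (filter_up filF (dres_comp_arg a x i)). Qed.

End Filter.

Section Ultrafilter.
Variable F : set A.
Hypothesis ultF : is_ultra F.
Let filF := ultra_filter ultF.

Lemma germ_refl x : germ_eq F x x.
Proof. by exists (proj i0) => //; apply: ultra_proj. Qed.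

Lemma ultra_anti x i : F (anti i x) <-> ~ F x.
Proof.
split=> [Fx' Fx|]; last by case: (ultra_or ultF x i).
apply: (ultra_proper ultF); rewrite -(ares_diag0 x) -(dresN i).
exact: filter_meet.
Qed.

Lemma germ_dres_all a x : (forall i, F (a i)) -> germ_eq F (dres_all a x) x.
Proof.
move=> Fa; rewrite /dres_all.
elim: (enum _) => [|j s IH] /=; first exact: germ_refl.
by apply: germ_trans (germ_dres _ _) IH.
Qed.

(** There are finitely many indices, so one member of the filter works for all
of them. *)
Lemma germ_eq_family a b : (forall i, germ_eq F (a i) (b i)) ->
  exists2 d, F d & forall i, dres d (a i) = dres d (b i).
Proof.
move=> ab.
have /choice [c cP] i : exists d, F d /\ dres d (a i) = dres d (b i).
  by case: (ab i) => d; exists d.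
exists (dres_all c (proj i0)) => [|i].
  by apply: filter_dres_all => [//|i|]; [case: (cP i) | apply: ultra_proj].
rewrite -(dres_dres_all c (proj i0) i) !dresA !(dresC (c i)).
by case: (cP i) => _ ->.
Qed.

Lemma germ_comp a b x :
  (forall i, germ_eq F (a i) (b i)) -> germ_eq F (a ;; x) (b ;; x).
Proof.
case/germ_eq_family => d Fd ab; exists d => //; rewrite !dres_compA //.
by congr (_ ;; _); apply: funext.
Qed.

Lemma comp_antiE a x i :
  a ;; anti i x = dres (anti i (a ;; x)) (dres_all a (a i)).
Proof. by rewrite comp_anti // dresN. Qed.

Lemma ultra_comp_anti a x i :
  F (a ;; anti i x) <-> (forall j, F (a j)) /\ ~ F (a ;; x).
Proof.
rewrite -(ultra_anti (a ;; x) i); split=> [Fax|[Fa Fx']].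
  split=> [j|]; first exact: filter_comp_arg Fax.
  by move: Fax; rewrite comp_antiE; apply: filter_dresl.
by rewrite comp_antiE; apply: filter_meet => //; apply: filter_dres_all.
Qed.

Lemma germ_comp_anti a x i :
  F (a ;; anti i x) -> germ_eq F (a ;; anti i x) (a i).
Proof.
move=> Fax; have [Fa nFx] := proj1 (ultra_comp_anti a x i) Fax.
rewrite comp_antiE; apply: germ_trans (germ_dres _ _) _ => //.
  exact/ultra_anti.
exact: germ_dres_all.
Qed.

Lemma ultra_comp_dom a x i : F (a ;; dom i x) <-> F (a ;; x).
Proof.
rewrite ultra_comp_anti; split=> [[Fa nF]|Fx].
  by apply: contrapT => nFx; apply: nF; apply/ultra_comp_anti.
split=> [j|/ultra_comp_anti [] //]; exact: filter_comp_arg Fx.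
Qed.

Lemma germ_comp_dom a x i : F (a ;; x) -> germ_eq F (a ;; dom i x) (a i).
Proof. by move/(ultra_comp_dom a x i); apply: germ_comp_anti. Qed.

(** The cancellation law transfers an equality of values to one of the
restricted arguments [a ;; dom i x], which have the germs of the [a i]. *)
Lemma germ_comp_inj a b x i :
  F (a ;; x) -> germ_eq F (a ;; x) (b ;; x) -> germ_eq F (a i) (b i).
Proof.
move=> Fax ab; have Fbx := germ_mem filF ab Fax.
apply: germ_trans (germ_sym (germ_comp_dom i Fax)) _ => //.
apply: germ_trans (germ_comp_dom i Fbx) => //.
case: ab => d Fd; rewrite !dres_compA // => ab; exists d => //.
by rewrite !dres_compA //; apply: comp_cancel.
Qed.

Lemma germ_fixs a x i :
  germ_eq F (a ;; x) (a i) -> germ_eq F (a ;; fixs i x) (a i).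
Proof.
case=> d Fd; rewrite dres_compA // => ax; exists d => //.
by rewrite dres_compA //; apply: comp_fixs (fun j => dres d (a j)) x i ax.
Qed.

(** Write [y] for [fixs i x].  Since [y] equals [dom i y], [a ;; y] has the germ
of [a i]; since [y] is [x] restricted to [y], it also has the germ
of [a ;; x]. *)
Lemma germ_comp_fixs a x i : F (a ;; fixs i x) ->
  germ_eq F (a ;; fixs i x) (a i) /\ germ_eq F (a ;; fixs i x) (a ;; x).
Proof.
move=> Fx; split; first by have := germ_comp_dom i Fx; rewrite dom_fixs.
rewrite -{1}(dres_fixs L x i) -(comp_assoc L).
by apply: germ_comp => j; apply: germ_comp_dom.
Qed.

End Ultrafilter.

(** Take a filter [M] maximal among those that do not identify [x] and [y].  If
[c] is not in [M], then the filter generated by [M] and [c] identifies [x] and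
[y], so some member of [M] does so after restriction to [c].  Were neither [c] nor
its complement in [M], the two members obtained would combine into one that
identifies [x] and [y] both on and off the domain of [c], hence everywhere. *)
Lemma ultra_separates x y : x <> y -> exists2 F, is_ultra F & ~ germ_eq F x y.
Proof.
move=> xy; pose P F := is_filter F /\ ~ germ_eq F x y.
have [C CP Ctot|M [[filM nxy] Mmax]] := @Zorn_bigcup A P.
  split; last by case=> d [F CF Fd] e; case: (CP F CF) => _; apply; exists d.
  split=> [d e [F CF Fd] [G CG Ge]|d e ed [F CF Fd]].
    have [FG|GF] := Ctot _ _ CF CG.
      by exists G => //; apply: (filter_meet (CP G CG).1) => //; apply: FG.
    by exists F => //; apply: (filter_meet (CP F CF).1) => //; apply: GF.
  by exists F => //; apply: (filter_up (CP F CF).1) ed Fd.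
(* Otherwise the filter of total elements would be strictly larger. *)
have [c0 Mc0] : M !=set0.
  apply/set0P/negP => /eqP M0.
  apply: (Mmax [set d | forall z, dres d z = z]).
    rewrite M0; split=> // /(_ (proj i0)); apply=> z; exact: dres_proj.
  split; last by case=> d /= dz; rewrite !dz.
  split=> /= [d e dz ez z|d e ed dz z]; first by rewrite dresA ez.
  by rewrite -[in RHS](dz z) -ed dresA dz.
have Mproj i : M (proj i).
  by apply: (filter_up filM) Mc0; rewrite dres_proj.
have absorb c : ~ M c -> exists2 d, M d & dres (dres d c) x = dres (dres d c) y.
  move=> nMc; apply: contrapT => nd.
  pose M' := [set e | exists2 d, M d & dres e (dres d c) = dres d c].
  apply: (Mmax M').
    split=> [e Me|M'M]; first by exists e => //; rewrite dres_dresK.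
    apply: nMc; apply: M'M; exists c0 => //.
    by rewrite dresC dres_diag.
  split; last first.
    case=> e [d Md edc] exy; apply: nd; exists d => //.
    by rewrite -edc !(dresA e) !(dresC e) exy.
  split=> [d e [d' Md dc] [e' Me ec]|d e ed [d' Md dc]].
    exists (dres d' e'); first exact: filter_meet.
    by rewrite !dresA (dresC e) ec (dresC d') (dresC d) dc.
  by exists d' => //; rewrite -{1}dc -dresA ed.
exists M => //; split=> //.
  by move=> M0; apply: nxy; exists zero => //; rewrite !zero_dres.
move=> c i; apply: contrapT => /not_orP [/absorb [d Md dxy] /absorb [e Me exy]].
apply: nxy; exists (dres d e); first exact: filter_meet.
apply: (dres_ares_eq L (d := c)).
  have swap z : dres c (dres (dres d e) z) = dres e (dres (dres d c) z).
    by rewrite !dresA (dresC d e) (dresC c) (dresC c).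
  by rewrite !swap dxy.
have swap z : dres (anti i c) (dres (dres d e) z) =
              dres d (dres (dres e (anti i c)) z).
  by rewrite !dresA (dresC _ d) (dresC _ e).
by rewrite -!(dresN i) !swap exy.
Qed.

(** * The representation by partial functions on germs *)

Definition germ F x : set A := [set y | germ_eq F x y].

(** Recording the ultrafilter next to the germ lets the equivalence of points be
read off without recovering the one from the other. *)
Definition point : Type :=
  {p : set A * set A | is_ultra p.1 /\ exists2 x, p.1 x & p.2 = germ p.1 x}.

Implicit Types (p q : point) (ps rs : 'I_n -> point).

Definition same_ultra p q : Prop := (sval p).1 = (sval q).1.

Definition at_germ F x p : Prop := sval p = (F, germ F x).

Definition rep x : nrel n point := [set pq | exists F a,
  [/\ is_ultra F, forall i, at_germ F (a i) (pq.1 i), F (a ;; x)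
    & at_germ F (a ;; x) pq.2]].

Lemma point_exists F x : is_ultra F -> F x -> exists p, at_germ F x p.
Proof.
move=> uF Fx.
have pF : is_ultra (F, germ F x).1 /\
  exists2 y, (F, germ F x).1 y & (F, germ F x).2 = germ (F, germ F x).1 y.
  by split=> //; exists x.
by exists (exist _ (F, germ F x) pF).
Qed.

Lemma at_germ_uniq F x p q : at_germ F x p -> at_germ F x q -> p = q.
Proof.
case: p q => [p pP] [q qP]; rewrite /at_germ /= => ep eq.
by apply: eq_exist; rewrite ep eq.
Qed.

Lemma at_germ_eq F x y p :
  is_ultra F -> at_germ F x p -> at_germ F y p -> germ_eq F x y.
Proof.
move=> uF; rewrite /at_germ => -> [exy].
by have : germ F y y by [exact: (germ_refl uF)]; rewrite -exy.
Qed.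

Lemma at_germ_congr F x y p :
  is_ultra F -> germ_eq F x y -> at_germ F x p -> at_germ F y p.
Proof.
move=> uF xy; rewrite /at_germ => ->; congr (_, _).
have fF := ultra_filter uF.
apply/seteqP; split=> z /=; apply: (germ_trans fF) => //.
exact: germ_sym.
Qed.

Lemma tuple_germs ps : (forall j k, same_ultra (ps j) (ps k)) ->
  exists F a, [/\ is_ultra F, forall i, F (a i)
                & forall i, at_germ F (a i) (ps i)].
Proof.
move=> same; exists (sval (ps i0)).1.
have /choice [a aP] : forall i, exists x,
    (sval (ps i0)).1 x /\ at_germ (sval (ps i0)).1 x (ps i).
  move=> i; have := same i i0; rewrite /same_ultra /at_germ.
  case: (ps i) => -[F g] /= [_ [x Fx ->]] <-.
  by exists x.
exists a; split=> [|i|i]; [|exact: (aP i).1|exact: (aP i).2].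
by case: (ps i0) => ? [].
Qed.

(** The value of [rep x] at a tuple of germs may be computed from any choice of
representatives, since composition respects germs. *)
Lemma rep_at F a x ps q : is_ultra F -> (forall i, at_germ F (a i) (ps i)) ->
  rep x (ps, q) <-> F (a ;; x) /\ at_germ F (a ;; x) q.
Proof.
move=> uF aps; split=> [[G [b [/= uG bps Gbx bq]]]|[Fax aq]]; last first.
  by exists F, a.
have FG : F = G by have := bps i0; rewrite /at_germ (aps i0) => -[].
subst G; have bax : germ_eq F (b ;; x) (a ;; x).
  by apply: germ_comp => // i; apply: at_germ_eq (bps i) (aps i).
split; first exact: germ_mem (ultra_filter uF) _ _ bax Gbx.
exact: at_germ_congr bax bq.
Qed.

Lemma rep_pfun x : is_pfun (rep x).
Proof.
move=> ps q r [F [a [uF aps _ aq]]] /(rep_at _ _ uF aps) [_].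
exact: at_germ_uniq aq.
Qed.

Lemma rep_within x : within same_ultra (rep x).
Proof.
move=> ps q [F [a [_ /= aps _ aq]]]; rewrite /same_ultra.
by split=> [i j|i]; rewrite !(aps, aq).
Qed.

Lemma rep_injective x : is_injective (rep x).
Proof.
move=> ps rs q [F [a [uF /= aps Fax aq]]] [G [b [/= uG brs Gbx bq]]].
have FG : F = G by move: aq bq; rewrite /at_germ => -> [].
subst G; apply: funext => i.
apply: at_germ_uniq (brs i); apply: at_germ_congr (aps i) => //.
by apply: germ_comp_inj Fax _; first exact: uF; apply: at_germ_eq aq bq.
Qed.

Lemma rep_comp a x : rep (a ;; x) = pfcomp (fun i => rep (a i)) (rep x).
Proof.
apply/seteqP; split=> -[ps q].
  case=> F [b [uF /= bps]]; rewrite -(comp_assoc L) => Fx bq.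
  have Fba i : F (b ;; a i) by apply: filter_comp_arg Fx; case: uF.
  have /choice [rs rsP] i := point_exists uF (Fba i).
  exists rs; split=> [i|]; first by apply/(rep_at _ _ uF bps).
  exact/(rep_at _ _ uF rsP).
case=> rs /= [ars xr]; have [F [b [uF /= bps _ _]]] := ars i0.
apply/(rep_at _ _ uF bps); rewrite -(comp_assoc L).
apply: (proj1 (rep_at x q uF _)) xr => i.
by have /(rep_at _ _ uF bps) [] := ars i.
Qed.

Lemma rep_anti i x : rep (anti i x) = pfanti same_ultra i (rep x).
Proof.
apply/seteqP; split=> -[ps q].
  case=> F [a [uF /= aps Fax aq]]; split=> /=.
  - apply: at_germ_uniq (aps i); apply: at_germ_congr aq => //.
    exact: germ_comp_anti.
  - by move=> j k; rewrite /same_ultra !aps.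
  - case=> r /(rep_at _ _ uF aps) [Fx _].
    by have [_] := proj1 (ultra_comp_anti uF a x i) Fax.
case=> /= -> /tuple_germs [F [a [uF Fa aps]]] nx.
apply/(rep_at _ _ uF aps).
have Fax : F (a ;; anti i x).
  apply/ultra_comp_anti => //; split=> // Fx; apply: nx.
  by have [r ar] := point_exists uF Fx; exists r; apply/(rep_at _ _ uF aps).
split=> //; apply: at_germ_congr (aps i) => //.
by apply: germ_sym; apply: germ_comp_anti.
Qed.

Lemma rep_fixs i x : rep (fixs i x) = pffix i (rep x).
Proof.
apply/seteqP; split=> -[ps q].
  case=> F [a [uF /= aps Fax aq]].
  have [fa fx] := germ_comp_fixs uF Fax.
  split=> /=; first exact: at_germ_uniq (at_germ_congr uF fa aq) (aps i).
  apply/(rep_at _ _ uF aps); split; last exact: at_germ_congr fx aq.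
  by apply: germ_mem fx Fax; case: uF.
case=> /= -> [F [a [uF /= aps Fax ai]]].
have fa := germ_fixs (at_germ_eq uF ai (aps i)).
have fF := ultra_filter uF.
apply/(rep_at _ _ uF aps); split; last first.
  exact: at_germ_congr (germ_sym fa) (aps i).
exact: germ_mem (germ_sym fa) (filter_comp_arg fF i Fax).
Qed.

(** Evaluate at the germs of the projections: composed with [x], they give
[x]. *)
Lemma rep_germ_eq x y F :
  is_ultra F -> rep x = rep y -> F x -> germ_eq F x y.
Proof.
move=> uF xy Fx.
have /choice [ps psP] i := point_exists uF (ultra_proj uF i).
have [q xq] := point_exists uF Fx.
have : rep x (ps, q) by apply/(rep_at _ _ uF psP); rewrite (proj_comp L).
rewrite xy => /(rep_at _ _ uF psP); rewrite (proj_comp L) => -[_ yq].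
exact: at_germ_eq xq yq.
Qed.

(** At an ultrafilter separating [x] and [y], the previous lemma excludes that
either of them is a member; but all non-members share the germ of zero. *)
Lemma rep_inj x y : rep x = rep y -> x = y.
Proof.
move=> xy; apply: contrapT => /ultra_separates [F uF]; apply.
have [Fx|nFx] := pselect (F x); first exact: rep_germ_eq xy Fx.
have [Fy|nFy] := pselect (F y); first exact/germ_sym/(rep_germ_eq uF (esym xy)).
have Fd z : ~ F z -> germ_eq F z zero.
  by move/(ultra_anti uF z i0) => Fz; exists (anti i0 z) => //;
    rewrite dresN ares_diag0 // dres_zero.
have fF := ultra_filter uF.
apply: (germ_trans fF) (Fd _ nFx) (germ_sym (Fd _ nFy)).
Qed.

Lemma laws_representable : injectively_representable A.
Proof.
exists point, same_ultra, (range rep), rep; split.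
- split.
  + by split=> [p|p q|p q r] //; rewrite /same_ultra => ->.
  + by exists (rep o), o.
  + by move=> _ [x _ <-]; split; [apply: rep_pfun | apply: rep_within].
  + move=> f _ rf [x _ <-].
    have /choice [a aP] i : exists y, rep y = f i.
      by case: (rf i) => y; exists y.
    exists (a ;; x) => //; rewrite rep_comp; congr (pfcomp _ _).
    exact: funext.
  + move=> i _ [x _ <-]; split; first by exists (anti i x); rewrite ?rep_anti.
    by exists (fixs i x); rewrite ?rep_fixs.
- by move=> _ [x _ <-]; apply: rep_injective.
- split; [split | exact: rep_comp | exact: rep_anti | exact: rep_fixs].
  + by move=> x _; exists x.
  + by move=> x y _ _; apply: rep_inj.
  + by move=> _ [x _ <-]; exists x.
Qed.

End Completeness.

Theorem corollary8p4 (n : nat) (hn : (1 <= n)%N) :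
  is_quasivariety (@injectively_representable n) /\
  axiomatised_by (@injectively_representable n)
    (fun q : quasieq n => List.In q (axioms n)).
Proof.
pose i0 := Ordinal hn.
suff Ax : axiomatised_by (@injectively_representable n)
    (fun q : quasieq n => List.In q (axioms n)).
  by split=> //; eexists; exact: Ax.
move=> A; apply: iff_trans (iff_sym (axioms_laws A)); split.
  case=> X [E [S [h [algS injS isoh]]]].
  exact: (representable_laws i0 algS injS isoh).
by case: (carrier_inhabited A) => o; apply: (laws_representable i0 o).
Qed.
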